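(* Let $-1<q<1$. The only orthogonal polynomial set which is also $\mathcal{D}_q$-Appell is the set of Rogers $q$-Hermite polynomials, in the normalization belonging to the $\mathcal{D}_q$-Appell property. That is, for a polynomial set $\{Q_n(x)\}_{n\ge 0}$ with $Q_0(x)=1$, the following are equivalent: (i) $\{Q_n(x)\}$ is an orthogonal polynomial set and is $\mathcal{D}_q$-Appell, i.e. $\mathcal{D}_q Q_n(x)=Q_{n-1}(x)$ for all $n\ge 1$; (ii) for all $n\ge 0$, $$Q_n(x)=\frac{(1-q)^n q^{n(n-1)/4}}{2^n (q;q)_n}\,H_n(x|q),$$ where $H_n(x|q)$ is the $n$th Rogers $q$-Hermite polynomial.
   Context: Notation: $(a;q)_0=1$ and $(a;q)_n=(1-a)(1-aq)\cdots(1-aq^{n-1})$ for $n\ge 1$. Askey–Wilson operator: for a polynomial $f$ in $x=\cos\theta$, view $f(\cos\theta)$ as a function $g(e^{i\theta})$ of $e^{i\theta}$, i.e. $g(z)=f\big((z+z^{-1})/2\big)$, and put $\delta_q f(x)=\delta_q g(e^{i\theta})=g(q^{1/2}e^{i\theta})-g(q^{-1/2}e^{i\theta})$. Then $$\mathcal{D}_q f(x)=\frac{\delta_q f(x)}{\delta_q x}.$$ $\mathcal{D}_q$-Appell: a polynomial set $\{P_n(x)\}_{n\ge0}$ is $\mathcal{D}_q$-Appell if there is a formal power series $A(t)$ with $A(0)=1$ such that $$A(t)\sum_{n=0}^\infty \frac{q^{n(n-1)/4}(1-q)^n}{2^n(q;q)_n}\Psi_n(x)\,t^n=\sum_{n=0}^\infty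 P_n(x)\,t^n,$$ where $\Psi_n(x)=i^n(iq^{(1-n)/2}e^{i\theta};q)_n(iq^{(1-n)/2}e^{-i\theta};q)_n$, $x=\cos\theta$; equivalently (with $P_0=1$), if $\mathcal{D}_qP_n(x)=P_{n-1}(x)$ for all $n\ge 1$. Orthogonal polynomial set: a polynomial set $\{P_n(x)\}_{n\ge 0}$ satisfying a three term recurrence relation $$P_{n+1}(x)=(A_nx+B_n)P_n(x)-C_nP_{n-1}(x),\qquad n=0,1,2,\dots,$$ with $P_0(x)=1$, $P_{-1}(x)=0$, and $A_nA_{n-1}C_n>0$. Rogers $q$-Hermite polynomials: $H_{n+1}(x|q)=2xH_n(x|q)-(1-q^n)H_{n-1}(x|q)$ for $n\ge 0$, with $H_0(x|q)=1$, $H_{-1}(x|q)=0$.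
   Formalization: The condition A_n A_{n-1} C_n > 0 is replaced by conj(A_n A_{n-1}) C_n > 0 with conj(A_n) B_n real, since for -1<q<0 the set in (ii) has A_1 A_0 C_1 < 0; for 0<q<1 this agrees with the original. At q=0, where D_q is undefined, both sides are false by convention. *)

(* Defs.v *)
From mathcomp Require Import all_boot all_order all_algebra.
From mathcomp Require Import complex.
From mathcomp Require Import reals trigo.

Set Implicit Arguments.
Unset Strict Implicit.
Unset Printing Implicit Defensive.

Import Order.TTheory GRing.Theory Num.Theory.
Local Open Scope ring_scope.
Local Open Scope complex_scope.

(* Everything lives over the complex numbers R[i]: for q < 0 the number
   q^(1/2), hence every D_q-Appell set, is genuinely complex.
   [sqrtC] is the principal square root, so q^(1/2) >= 0 for q >= 0 and
   q^(1/2) = i |q|^(1/2) for q < 0. *)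
Definition qhalf (R : realType) (q : R) : R[i] := sqrtC (q%:C).

Definition qpoch (K : comNzRingType) (a q : K) (n : nat) : K :=
  \prod_(i < n) (1 - a * q ^+ i).

Definition expi (R : realType) (theta : R) : R[i] :=
  cos theta +i* sin theta.

Definition joukowski (R : realType) (f : {poly R[i]}) (z : R[i]) : R[i] :=
  f.[(z + z^-1) / 2].

Definition aw_delta (R : realType) (q : R) (f : {poly R[i]}) (z : R[i]) :
    R[i] :=
  joukowski f (qhalf q * z) - joukowski f ((qhalf q)^-1 * z).

(* The value of D_q f at x = cos theta. For q = 0 the operator is undefined
   (it involves q^(-1/2)); the conventions 0^-1 = 0 and a / 0 = 0 make [aw_D]
   vanish there, so that no P with P_0 = 1 is [Dq_Appell] for q = 0. *)
Definition aw_D (R : realType) (q : R) (f : {poly R[i]}) (theta : R) : R[i] :=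
  aw_delta q f (expi theta) / aw_delta q 'X (expi theta).

Definition polynomial_set (R : realType) (P : nat -> {poly R[i]}) : Prop :=
  forall n, size (P n) = n.+1.

(* D_q P_n = P_(n-1) for n >= 1. The points x = 1 and x = -1, where the
   quotient defining D_q reads 0 / 0, are left out; an identity between
   polynomials is determined by the remaining x in ]-1, 1[. *)
Definition Dq_Appell (R : realType) (q : R) (P : nat -> {poly R[i]}) : Prop :=
  forall (n : nat) (theta : R), sin theta != 0 ->
    aw_D q (P n.+1) theta = (P n).[(cos theta)%:C].

(* Three term recurrence with P_0 = 1, P_(-1) = 0. For real A, B, C the last
   two conditions say exactly A_n A_(n-1) C_n > 0 for n >= 1. Since
   normalizations may be complex, the conditions are written so that they do
   not change when each P_n is multiplied by a nonzero complex constant: they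
   hold iff the monic polynomials proportional to the P_n satisfy
   p_(n+1) = (x + b_n) p_n - c_n p_(n-1) with b_n real and c_n > 0. *)
Definition orthogonal_polynomial_set (R : realType) (P : nat -> {poly R[i]}) :
    Prop :=
  P 0%N = 1 /\
  exists A B C : nat -> R[i],
    [/\ forall n, P n.+1 = (A n *: 'X + (B n)%:P) * P n
                           - C n *: (if n is m.+1 then P m else 0),
        forall n, (A n)^*%R * B n \is Num.real
      & forall n, 0 < (A n.+1 * A n)^*%R * C n.+1].

Fixpoint qHermite (K : comNzRingType) (q : K) (n : nat) : {poly K} :=
  if n is n'.+1 then
    2 *: 'X * qHermite q n'
    - (1 - q ^+ n') *: (if n' is m.+1 then qHermite q m else 0)
  else 1.

(* n(n-1)/2 = 'C(n, 2), so q^(n(n-1)/4) = (q^(1/2))^('C(n, 2)). *)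
Definition qHermite_Appell (R : realType) (q : R) (n : nat) : {poly R[i]} :=
  ((1 - q%:C) ^+ n * qhalf q ^+ 'C(n, 2) / (2 ^+ n * qpoch q%:C q%:C n))
    *: qHermite q%:C n.

(* Main.v *)
(** Write h_n for the Appell normalization of the q-Hermite polynomials and
    s = q^(1/2). Then x h_n = u_n h_(n+1) + v_(n-1) h_(n-1) with
    u_n = (1 - q^(n+1)) / ((1 - q) s^n) and v_n = (1 - q) s^n / 4, and
    D_q h_(n+1) = h_n. The latter follows from the shift formula
    s^n H_n(s z) = z (H_(n+1)(z) - z H_n(z)) and its image under z -> 1/z.

    If Q is D_q-Appell, then Q_n = \sum_k a_k h_(n-k) for a single sequence a.
    Comparing the coefficients of h_(n+1), ..., h_(n-3) in the three term
    recurrence expresses A_n, B_n, C_n through a_1, a_2 and leaves two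
    relations that are affine in q^n; since they hold for n = 4 and n = 5, the
    constant and the linear part both vanish. The resulting system has three
    kinds of solutions: a_1 = a_2 = 0; the q^-1-Hermite polynomials, for which
    the positivity condition fails at n = 4; and a family with C_n = 0. So
    a_1 = a_2 = 0, and the coefficient of h_0 in the recurrence then gives
    a_k = 0 for all k >= 1. *)

Require Import Defs.
From mathcomp Require Import all_boot all_order all_algebra.
From mathcomp Require Import complex ring zify.
From mathcomp Require Import boolp reals trigo.
Import Order.TTheory GRing.Theory Num.Theory.
Local Open Scope ring_scope.
Local Open Scope complex_scope.
Set Implicit Arguments.
Unset Strict Implicit.

(** * Coordinates in a basis with a three term recurrence *)

Section Expansion.
Variables (K : fieldType) (h : nat -> {poly K}) (u v : nat -> K).
Hypotheses (h0 : h 0%N = 1) (size_h : forall n, size (h n) = n.+1)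
  (mulXh0 : 'X * h 0%N = u 0%N *: h 1%N)
  (mulXh : forall n, 'X * h n.+1 = u n.+1 *: h n.+2 + v n *: h n).

(** A finitely supported coordinate sequence is stored as a polynomial: ['X^n] encodes [h n], and
    [drop_poly 1] will encode D_q. *)
Definition comb (c : {poly K}) := \sum_(i < size c) c`_i *: h i.

Lemma comb_widen (c : {poly K}) N :
  (size c <= N)%N -> comb c = \sum_(i < N) c`_i *: h i.
Proof.
move=> le_cN; rewrite /comb (big_ord_widen _ (fun i => c`_i *: h i) le_cN) big_mkcond.
by apply: eq_bigr => i _; case: ltnP => // /(nth_default 0) ->; rewrite scale0r.
Qed.

Lemma comb_linear (a : K) (c d : {poly K}) :
  comb (a *: c + d) = a *: comb c + comb d.
Proof.
pose N := maxn (size c) (size d).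
rewrite !(@comb_widen _ N) ?leq_maxl ?leq_maxr //; last first.
  rewrite (leq_trans (size_polyD _ _)) // geq_max leq_maxr andbT.
  by rewrite (leq_trans (size_scale_leq _ _)) // leq_maxl.
rewrite scaler_sumr -big_split; apply: eq_bigr => i _ /=.
by rewrite coefD coefZ scalerDl scalerA.
Qed.

Lemma combB (c d : {poly K}) : comb (c - d) = comb c - comb d.
Proof. by rewrite addrC -scaleN1r comb_linear scaleN1r addrC. Qed.

Lemma comb_const (a : K) : comb a%:P = a%:P.
Proof.
rewrite (@comb_widen _ 1) ?size_polyC ?leq_b1 // big_ord1 coefC /= h0.
by rewrite alg_polyC.
Qed.

Lemma combXn n : comb 'X^n = h n.
Proof.
rewrite /comb size_polyXn big_ord_recr /= coefXn eqxx scale1r big1 ?add0r // => i _.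
by rewrite coefXn ltn_eqF // scale0r.
Qed.

(** The degrees of the [h i] are distinct, so only the top term of a nonzero combination reaches its
    leading coefficient. *)
Lemma comb_inj : injective comb.
Proof.
move=> c d /eqP; rewrite -subr_eq0 -combB => /eqP e.
apply/eqP; rewrite -subr_eq0; move: (c - d) e => {c d} c e; apply/negPn/negP => c0.
have [N sc] : exists N, size c = N.+1.
  by exists (size c).-1; rewrite prednK // lt0n size_poly_eq0.
have : (comb c)`_N == 0 by rewrite e coef0.
rewrite /comb sc big_ord_recr /= coefD coef_sum big1 => [|i _]; last first.
  by rewrite coefZ [(h i)`_N]nth_default ?mulr0 // size_h.
rewrite add0r coefZ mulf_eq0; have -> : c`_N = lead_coef c by rewrite lead_coefE sc.
have -> : (h N)`_N = lead_coef (h N) by rewrite lead_coefE size_h.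
by rewrite !lead_coef_eq0 (negPf c0) -size_poly_eq0 size_h.
Qed.

(** Multiplication by ['X] is tridiagonal in the basis [h]; the bound on [j] cuts off only zeros. *)
Definition mulX_coef (c : {poly K}) : {poly K} :=
  \poly_(j < (size c).+1)
    ((if j is i.+1 then u i * c`_i else 0) + v j * c`_j.+1).

Lemma coef_mulX_coef (c : {poly K}) j :
  (mulX_coef c)`_j =
    (if j is i.+1 then u i * c`_i else 0) + v j * c`_j.+1.
Proof.
rewrite coef_poly; case: ltnP => // lt_cj.
have c0 i : (j <= i.+1)%N -> c`_i = 0.
  by move=> le_ji; rewrite nth_default // -ltnS (leq_trans lt_cj).
case: j {lt_cj} c0 => [|j] c0; first by rewrite (c0 1%N) // mulr0 addr0.
by rewrite (c0 j (leqnn _)) (c0 j.+2 (ltnW (leqnSn _))) !mulr0 addr0.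
Qed.

Lemma mulX_comb (c : {poly K}) : 'X * comb c = comb (mulX_coef c).
Proof.
rewrite (@comb_widen c (size c).+1) //.
rewrite (@comb_widen (mulX_coef c) (size c).+2); last first.
  exact: leq_trans (size_poly _ _) _.
under [RHS]eq_bigr do rewrite coef_mulX_coef scalerDl.
rewrite [RHS]big_split /= [X in _ = X + _]big_ord_recl /= scale0r add0r.
rewrite [X in _ = X + _]big_ord_recl /=.
rewrite [X in _ = _ + X]big_ord_recr /=.
rewrite [c`_(size c).+2]nth_default ?leqW // mulr0 scale0r addr0.
rewrite [X in _ = _ + X]big_ord_recr /=.
rewrite [c`_(size c).+1]nth_default // mulr0 scale0r addr0.
rewrite mulr_sumr big_ord_recl /= -scalerAr mulXh0 scalerA mulrC -addrA; congr (_ + _).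
rewrite -big_split; apply: eq_bigr => i _ /=.
by rewrite -scalerAr mulXh scalerDr !scalerA [c`_i.+1 * _]mulrC [c`_i.+1 * _]mulrC.
Qed.

(** Horner induction: the range contains the constants and is closed under sums and under
    multiplication by ['X]. *)
Lemma comb_surj (p : {poly K}) : exists c, p = comb c.
Proof.
elim/poly_ind: p => [|p a [c ->]]; first by exists 0; rewrite comb_const.
exists (1 *: mulX_coef c + a%:P).
by rewrite comb_linear comb_const -mulX_comb scale1r mulrC.
Qed.

Lemma comb_recurrence (a b d : K) (c1 c2 c3 : {poly K}) :
  comb c1 = (a *: 'X + b%:P) * comb c2 - d *: comb c3 -> forall j,
  c1`_j = a * (mulX_coef c2)`_j + b * c2`_j - d * c3`_j.
Proof.
move=> e j.
have -> : c1 = a *: mulX_coef c2 + (b *: c2 + (- d *: c3 + 0)).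
  apply: comb_inj; rewrite e !comb_linear -mulX_comb comb_const addr0 mulrDl.
  by rewrite -scalerAl mul_polyC scaleNr addrA.
by rewrite addr0 !coefD !coefZ mulNr addrA.
Qed.

End Expansion.

(** * Equations for the first Appell coefficients, with q = [s ^+ 2] *)

Definition up (K : fieldType) (s : K) n :=
  (1 - s ^+ 2 ^+ n.+1) / ((1 - s ^+ 2) * s ^+ n).
Definition down (K : fieldType) (s : K) n := (1 - s ^+ 2) * s ^+ n / 4.

(** The equations are the coefficients of h_(n+1), ..., h_(n-3) in the recurrence at n = m + 4, and
    X = q^n. The last two conclusions are sorted by powers of X, so that their brackets do not
    depend on m. *)
Lemma appell_recurrence_relations (K : fieldType) (s A B C a1 a2 a3 a4 : K) (m : nat) :
  2 != 0 :> K -> s != 0 -> (forall n, 1 - s ^+ 2 ^+ n.+1 != 0) ->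
  1 = A * up s m.+4 ->
  a1 = A * (up s m.+3 * a1) + B ->
  a2 = A * (up s m.+2 * a2 + down s m.+3) + B * a1 - C ->
  a3 = A * (up s m.+1 * a3 + down s m.+2 * a1) + B * a2 - C * a1 ->
  a4 = A * (up s m * a4 + down s m.+1 * a2) + B * a3 - C * a2 ->
  let X := s ^+ 2 ^+ m.+4 in
  [/\ (1 - s ^+ 2 * X) * C =
        (1 - s ^+ 2) ^+ 2 * X / (4 * s) + a1 ^+ 2 * (1 - s) * (1 + s * X)
        - a2 * (1 - s ^+ 2) * (1 + X),
      (a3 * (1 - s ^+ 3) - (a2 - a1 ^+ 2) * a1 * (1 - s)
        - a1 * a2 * (1 - s ^+ 2)) +
      X / s * (a3 * (1 - s ^+ 3) - a1 * (1 - s ^+ 2) ^+ 2 * (s^-1 - 1) / 4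
        - (a2 - a1 ^+ 2) * a1 * (1 - s) * s ^+ 2
        - a1 * a2 * s * (1 - s ^+ 2)) = 0 &
      (a4 * (1 - s ^+ 4) - a1 * a3 * (1 - s) + a2 * a1 ^+ 2 * (1 - s)
        - a2 ^+ 2 * (1 - s ^+ 2)) +
      X / s ^+ 2 * (a4 * (1 - s ^+ 4) - a2 * (1 - s ^+ 2) ^+ 3 / 4 / s
        - (a1 * a3 - a2 * a1 ^+ 2) * (1 - s) * s ^+ 3
        - a2 ^+ 2 * s ^+ 2 * (1 - s ^+ 2)) = 0].
Proof.
move=> two s0 qn; have q1 := qn 0%N; rewrite expr1 in q1.
set Y := s ^+ m; have Y0 : Y != 0 by rewrite expf_neq0.
(* With [Y] factored out, all remaining exponents are numerals and [field] applies. *)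
pose u k := (1 - s ^+ (2 + 2 * k) * Y ^+ 2) / ((1 - s ^+ 2) * (s ^+ k * Y)).
pose v k := (1 - s ^+ 2) * (s ^+ k * Y) / 4.
have uE k : up s (k + m) = u k.
  by rewrite /up /u /Y -!exprM -!exprD; congr ((1 - s ^+ _) / _); lia.
have vE k : down s (k + m) = v k by rewrite /down exprD.
rewrite (uE 4%N) (uE 3%N) (uE 2%N) (uE 1%N) (uE 0%N) (vE 3%N) (vE 2%N) (vE 1%N).
have -> : s ^+ 2 ^+ m.+4 = s ^+ 8 * Y ^+ 2.
  by rewrite -!exprM -exprD; congr (s ^+ _); lia.
have D : 1 - s ^+ 10 * Y ^+ 2 != 0.
  have -> : s ^+ 10 * Y ^+ 2 = s ^+ 2 ^+ m.+4.+1; last exact: qn.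
  by rewrite -!exprM -exprD; congr (s ^+ _); lia.
move=> e0 e1 e2 e3 e4 /=.
have four : 4 != 0 :> K by have -> : 4 = 2 * 2 :> K by [ring]; rewrite mulf_neq0.
(* The first three equations determine A, B and C; the last two become constraints on the a_k. *)
have eA : A = (1 - s ^+ 2) * (s ^+ 4 * Y) / (1 - s ^+ 10 * Y ^+ 2).
  have : A * (1 - s ^+ 10 * Y ^+ 2) = (1 - s ^+ 2) * (s ^+ 4 * Y) * (A * u 4%N).
    by rewrite /u; field; rewrite s0 Y0 q1.
  by rewrite -e0 mulr1 => <-; rewrite mulfK.
have eB : B = a1 - A * (u 3%N * a1) by rewrite {1}e1; ring.
have eC : C = A * (u 2%N * a2 + v 3%N) + B * a1 - a2 by rewrite {2}e2; ring.
split.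
- by rewrite eC eB eA /u /v; field; rewrite s0 Y0 q1 D four.
(* The factor is the denominator of [A]. *)
- have -> : 0 = (1 - s ^+ 10 * Y ^+ 2) *
      (a3 - (A * (u 1%N * a3 + v 2%N * a1) + B * a2 - C * a1)).
    by rewrite -e3 subrr mulr0.
  by rewrite eC eB eA /u /v; field; rewrite s0 Y0 q1 D four.
- have -> : 0 = (1 - s ^+ 10 * Y ^+ 2) *
      (a4 - (A * (u 0%N * a4 + v 1%N * a2) + B * a3 - C * a2)).
    by rewrite -e4 subrr mulr0.
  by rewrite eC eB eA /u /v; field; rewrite s0 Y0 q1 D four.
Qed.

Lemma affine_eq0 (K : fieldType) (r x y X Y : K) :
  X != Y -> r != 0 -> x + X / r * y = 0 -> x + Y / r * y = 0 -> x = 0 /\ y = 0.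
Proof.
move=> XY r0 hx hy.
have y0 : y = 0.
  apply: contraNeq XY => y0; apply/eqP/(mulIf (_ : r^-1 != 0)); first by rewrite invr_eq0.
  by apply: (mulIf y0); apply: (addrI x); rewrite hx hy.
by split=> //; rewrite -hx y0 mulr0 addr0.
Qed.

(** The second alternative belongs to the q^-1-Hermite polynomials; the third is the family with C_n
    = 0. *)
Lemma appell_relations_solve (K : fieldType) (s a1 a2 a3 a4 : K) :
  2 != 0 :> K -> s != 0 -> 1 - s ^+ 2 != 0 ->
  a3 * (1 - s ^+ 3) - (a2 - a1 ^+ 2) * a1 * (1 - s)
    - a1 * a2 * (1 - s ^+ 2) = 0 ->
  a3 * (1 - s ^+ 3) - a1 * (1 - s ^+ 2) ^+ 2 * (s^-1 - 1) / 4
    - (a2 - a1 ^+ 2) * a1 * (1 - s) * s ^+ 2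
    - a1 * a2 * s * (1 - s ^+ 2) = 0 ->
  a4 * (1 - s ^+ 4) - a1 * a3 * (1 - s) + a2 * a1 ^+ 2 * (1 - s)
    - a2 ^+ 2 * (1 - s ^+ 2) = 0 ->
  a4 * (1 - s ^+ 4) - a2 * (1 - s ^+ 2) ^+ 3 / 4 / s
    - (a1 * a3 - a2 * a1 ^+ 2) * (1 - s) * s ^+ 3
    - a2 ^+ 2 * s ^+ 2 * (1 - s ^+ 2) = 0 ->
  [\/ a1 = 0 /\ a2 = 0, a1 = 0 /\ a2 = (1 - s ^+ 2) / (4 * s) |
    a1 ^+ 2 = (1 + s) ^+ 2 / (4 * s) /\ a2 = (1 + s) / (4 * s)].
Proof.
move=> two s0 q1 e1 e2 e3 e4.
have four : 4 != 0 :> K by have -> : 4 = 2 * 2 :> K by [ring]; rewrite mulf_neq0.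
have s1 : 1 - s != 0.
  apply: contra_neq q1 => s1.
  by have -> : 1 - s ^+ 2 = (1 - s) * (1 + s) by [ring]; rewrite s1 mul0r.
(* Subtracting the relations in pairs eliminates [a3] from the first pair and [a4] from the
   second. *)
have f1 : a1 * (2 * a2 - a1 ^+ 2 - (1 - s ^+ 2) / (4 * s)) = 0.
  apply: (mulfI (mulf_neq0 s1 q1)); rewrite mulr0 -[RHS](subrr 0) -{1}e2 -e1.
  by field; rewrite s0 four.
have f2 : (a1 * a3 - a1 ^+ 2 * a2) * (1 - s) * (1 - s ^+ 3)
    + a2 ^+ 2 * (1 - s ^+ 2) ^+ 2 - a2 * (1 - s ^+ 2) ^+ 3 / (4 * s) = 0.
  rewrite -[RHS](subrr 0) -{1}e4 -e3.
  by field; rewrite s0 four.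
have [a10|a1n0] := eqVneq a1 0.
  have : a2 * (a2 - (1 - s ^+ 2) / (4 * s)) = 0.
    apply: (mulfI (mulf_neq0 q1 q1)); rewrite mulr0 -f2 a10.
    by field; rewrite s0 four.
  move/eqP; rewrite mulf_eq0 subr_eq0 => /orP[] /eqP ->; first by constructor 1.
  by constructor 2.
have ea2 : a2 = (a1 ^+ 2 + (1 - s ^+ 2) / (4 * s)) / 2.
  move/eqP: f1; rewrite mulf_eq0 (negPf a1n0) /= => /eqP f1.
  rewrite -[RHS]addr0 -[X in _ + X](mul0r 2^-1) -f1.
  by field; rewrite s0 two four.
(* Eliminating [a2] and [a3] from [f2] leaves a perfect square in [a1 ^+ 2]. *)
have e : ((1 - s) * a1 ^+ 2 - (1 + s) * (1 - s ^+ 2) / (4 * s)) ^+ 2 = 0.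
  apply: (mulfI (mulf_neq0 s1 s1)); rewrite mulr0.
  have -> : 0 = - 4 * ((a1 * a3 - a1 ^+ 2 * a2) * (1 - s) * (1 - s ^+ 3)
      + a2 ^+ 2 * (1 - s ^+ 2) ^+ 2 - a2 * (1 - s ^+ 2) ^+ 3 / (4 * s)
      - a1 * (1 - s) * (a3 * (1 - s ^+ 3) - (a2 - a1 ^+ 2) * a1 * (1 - s)
        - a1 * a2 * (1 - s ^+ 2))).
    by rewrite f2 e1; ring.
  by rewrite ea2; field; rewrite s0 two four.
have ea1 : a1 ^+ 2 = (1 + s) ^+ 2 / (4 * s).
  move/eqP: e; rewrite expf_eq0 /= subr_eq0 => /eqP e.
  by apply: (mulfI s1); rewrite e; field; rewrite s0 four.
by constructor 3; split=> //; rewrite ea2 ea1; field; rewrite s0 two four.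
Qed.

Definition appell_coef (K : fieldType) (s : K) (n : nat) : K :=
  (1 - s ^+ 2) ^+ n * s ^+ 'C(n, 2) / (2 ^+ n * qpoch (s ^+ 2) (s ^+ 2) n).

Definition appellH (K : fieldType) (s : K) (n : nat) : {poly K} :=
  appell_coef s n *: qHermite (s ^+ 2) n.

(** * The q-Hermite basis and its behaviour under z -> s z *)

Section Basis.
Variables (K : fieldType) (s : K).
Hypotheses (two_neq0 : 2 != 0 :> K) (s_neq0 : s != 0)
  (q_neq1 : forall n, 1 - s ^+ 2 ^+ n.+1 != 0).

Notation h := (appellH s).

Lemma four_neq0 : 4 != 0 :> K.
Proof. by have -> : 4 = 2 * 2 :> K by [ring]; rewrite mulf_neq0. Qed.

Lemma oneBq_neq0 : 1 - s ^+ 2 != 0.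
Proof. exact: q_neq1 0%N. Qed.

Lemma qHermiteSS (q : K) n :
  qHermite q n.+2 = 2 *: 'X * qHermite q n.+1 - (1 - q ^+ n.+1) *: qHermite q n.
Proof. by []. Qed.

Lemma qpochS (a q : K) n : qpoch a q n.+1 = qpoch a q n * (1 - a * q ^+ n).
Proof. exact: big_ord_recr. Qed.

Lemma qpoch_neq0 n : qpoch (s ^+ 2) (s ^+ 2) n != 0.
Proof. by apply/prodf_neq0 => i _; rewrite -exprS q_neq1. Qed.

Lemma appell_coef0 : appell_coef s 0 = 1.
Proof. by rewrite /appell_coef /qpoch big_ord0 bin_small // !expr0 !mulr1 divr1. Qed.

Lemma appell_coefS n :
  appell_coef s n.+1 =
    appell_coef s n * ((1 - s ^+ 2) * s ^+ n / (2 * (1 - s ^+ 2 ^+ n.+1))).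
Proof.
rewrite /appell_coef binS bin1 exprD qpochS.
have := q_neq1 n; have := qpoch_neq0 n.
rewrite [(1 - _) ^+ _]exprS [2 ^+ _]exprS [s ^+ 2 ^+ _]exprS => p0 p1.
by field; rewrite p0 p1 two_neq0 expf_neq0.
Qed.

Lemma appell_coef_neq0 n : appell_coef s n != 0.
Proof.
by rewrite !mulf_neq0 ?expf_neq0 ?invr_eq0 ?mulf_neq0 ?expf_neq0 ?qpoch_neq0 ?oneBq_neq0.
Qed.

Lemma size_qHermite (q : K) n : size (qHermite q n) = n.+1.
Proof.
elim/ltn_ind: n => -[_|[_|n IH]].
- exact: size_poly1.
- by rewrite /= mulr1 scaler0 subr0 size_scale // size_polyX.
have e : size (2 *: 'X * qHermite q n.+1) = n.+3.
  by rewrite -scalerAl mulrC size_scale // size_mulX -?size_poly_eq0 IH.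
rewrite [qHermite _ _]qHermiteSS size_polyDl e // size_polyN.
by rewrite (leq_ltn_trans (size_scale_leq _ _)) // IH.
Qed.

Lemma appellH0 : h 0 = 1.
Proof. by rewrite /appellH appell_coef0 scale1r. Qed.

Lemma size_appellH n : size (h n) = n.+1.
Proof. by rewrite size_scale ?size_qHermite // appell_coef_neq0. Qed.

Lemma mulX_appellH0 : 'X * h 0 = up s 0 *: h 1.
Proof.
rewrite appellH0 mulr1 /appellH /= scaler0 subr0 mulr1 !scalerA.
rewrite appell_coefS appell_coef0 /up.
rewrite -[LHS]scale1r; congr (_ *: _).
by have := oneBq_neq0; rewrite expr0 !expr1 => q1; field; rewrite q1 two_neq0.
Qed.

Lemma mulX_appellH n : 'X * h n.+1 = up s n.+1 *: h n.+2 + down s n *: h n.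
Proof.
rewrite /appellH [qHermite _ n.+2]qHermiteSS.
move: (qHermite _ n.+1) (qHermite _ n) => H1 H0.
rewrite scalerA scalerBr !scalerA -!scalerAl -scalerAr scalerA.
rewrite !appell_coefS -addrA -scaleNr -scalerDl /up /down.
have := q_neq1 n.+1; have := q_neq1 n; have := oneBq_neq0.
have sn0 : s ^+ n != 0 by rewrite expf_neq0.
have := four_neq0.
rewrite [s ^+ 2 ^+ n.+2]exprS [s ^+ 2 ^+ n.+1]exprS [s ^+ n.+1]exprS => f0 q0 q1 q2.
rewrite -[LHS]addr0 -[X in _ + X](scale0r H0); congr (_ *: _ + _ *: _); field;
  by rewrite ?q0 ?q1 ?q2 ?f0 ?two_neq0 ?s_neq0 ?sn0.
Qed.

(** In the generating function 1 / ((tz;q)_oo (t/z;q)_oo) of H_n / (q;q)_n, replacing z, t by sz, st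
    inserts the factor 1 - tz. This gives H_n - z (1 - q^n) H_(n-1), rewritten here without H_(n-1)
    by the recurrence. The proof is a two-step induction on that recurrence. *)
Lemma qHermite_shift (z : K) n : z != 0 ->
  s ^+ n * (qHermite (s ^+ 2) n).[(s * z + (s * z)^-1) / 2] =
  z * ((qHermite (s ^+ 2) n.+1).[(z + z^-1) / 2]
    - z * (qHermite (s ^+ 2) n).[(z + z^-1) / 2]).
Proof.
move=> z0.
have rec m x : (qHermite (s ^+ 2) m.+2).[x] = 2 * x * (qHermite (s ^+ 2) m.+1).[x]
    - (1 - s ^+ 2 ^+ m.+1) * (qHermite (s ^+ 2) m).[x].
  by rewrite [qHermite _ _]qHermiteSS !hornerE.
have H1 x : (qHermite (s ^+ 2) 1).[x] = 2 * x.
  by rewrite /= mulr1 scaler0 subr0 hornerZ hornerX.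
have H0 x : (qHermite (s ^+ 2) 0).[x] = 1 by rewrite /= hornerC.
elim/ltn_ind: n => -[_|[_|n IH]].
- by rewrite H1 !H0; field; rewrite z0 two_neq0.
- by rewrite rec !H1 !H0; field; rewrite z0 two_neq0 s_neq0.
have := IH n (ltnW (ltnSn _)); have := IH n.+1 (ltnSn _).
rewrite !rec; move: (_.[_]) (_.[_]) (_.[_]) (_.[_]) => y0 y1 y2 y3 e2 e3.
set X := (s * z + _) / 2.
transitivity (2 * s * X * (s ^+ n.+1 * y3)
  - (1 - s ^+ 2 ^+ n.+1) * s ^+ 2 * (s ^+ n * y0)).
  by rewrite !(exprS s); ring.
rewrite e2 e3 /X [s ^+ 2 ^+ n.+2]exprS; field.
by rewrite z0 s_neq0 two_neq0.
Qed.

(** The point belonging to z / s is also the one belonging to s / z, so the shift formula applies at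
    z and at 1/z; the recurrence then reduces the difference to H_n. *)
Lemma qHermite_shift_sub (z : K) n : z != 0 ->
  s ^+ n.+1 * ((qHermite (s ^+ 2) n.+1).[(s * z + (s * z)^-1) / 2]
    - (qHermite (s ^+ 2) n.+1).[(s^-1 * z + (s^-1 * z)^-1) / 2]) =
  (z^-1 - z) * (1 - s ^+ 2 ^+ n.+1) * (qHermite (s ^+ 2) n).[(z + z^-1) / 2].
Proof.
move=> z0; rewrite mulrBr qHermite_shift //.
have -> : (s^-1 * z + (s^-1 * z)^-1) / 2 = (s * z^-1 + (s * z^-1)^-1) / 2.
  by congr (_ / _); field; rewrite z0.
rewrite qHermite_shift ?invr_eq0 // invrK [z^-1 + z]addrC [qHermite _ n.+2]qHermiteSS.
rewrite hornerD hornerN -scalerAl !hornerZ hornerM hornerX.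
by move: (_.[_]) (_.[_]) => y0 y1; field; rewrite two_neq0 z0.
Qed.

(** This is D_q h_(n+1) = h_n with the denominator cleared: the factor on the right is delta_q x. *)
Lemma appellH_shift_sub (z : K) n : z != 0 ->
  (h n.+1).[(s * z + (s * z)^-1) / 2] - (h n.+1).[(s^-1 * z + (s^-1 * z)^-1) / 2] =
  (s - s^-1) * (z - z^-1) / 2 * (h n).[(z + z^-1) / 2].
Proof.
move=> z0; apply: (mulfI (_ : s ^+ n.+1 != 0)); first by rewrite expf_neq0.
rewrite !hornerZ -mulrBr mulrCA qHermite_shift_sub // appell_coefS [s ^+ n.+1]exprS.
have := q_neq1 n; set c := 1 - s ^+ 2 ^+ n.+1 => c0.
by field; rewrite ?z0 ?two_neq0 ?s_neq0 ?c0.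
Qed.

End Basis.

(** * Positivity leaves only the q-Hermite coefficients *)

Section Classification.
Variables (K : numClosedFieldType) (s : K).
Hypotheses (s_neq0 : s != 0) (q_lt1 : forall n, 0 < 1 - s ^+ 2 ^+ n.+1).

Let two_neq0 : 2 != 0 :> K. Proof. by rewrite pnatr_eq0. Qed.
Let q_neq1 n : 1 - s ^+ 2 ^+ n.+1 != 0. Proof. by rewrite gt_eqF. Qed.

Lemma q_real : s ^+ 2 \is Num.real.
Proof.
have := gtr0_real (q_lt1 0%N); rewrite expr1 => r.
by rewrite -[s ^+ 2](subKr 1) rpredB ?rpred1.
Qed.

(** The positive factor of 1 / u_n; what remains is [s ^+ n], which need not be real. *)
Let upV_scale n := (1 - s ^+ 2) / (1 - s ^+ 2 ^+ n.+1).

Lemma upV_scale_gt0 n : 0 < upV_scale n.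
Proof. by rewrite divr_gt0 // (q_lt1 0%N). Qed.

Lemma up_neq0 n : up s n != 0.
Proof. by rewrite mulf_neq0 ?invr_eq0 ?mulf_neq0 ?expf_neq0 // (q_neq1 0%N). Qed.

Lemma upV n : (up s n)^-1 = upV_scale n * s ^+ n.
Proof. by rewrite /up invf_div mulrAC. Qed.

(* [q] is real, so [s^* ^+ 7 / s] is [q ^+ 4] divided by [`|s| ^+ 2]. *)
Lemma conj_pow_div_gt0 : 0 < s^* ^+ 7 / s.
Proof.
have -> : s^* ^+ 7 / s = s^* ^+ 2 ^+ 4 / `|s| ^+ 2.
  by rewrite normCK; field; rewrite conjC_eq0 s_neq0.
rewrite -[s^* ^+ 2]rmorphXn /= conj_Creal ?q_real //; apply: divr_gt0.
  by rewrite real_exprn_even_gt0 ?q_real // !expf_neq0.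
by rewrite exprn_gt0 ?normr_gt0.
Qed.

(** Here [c n] holds the coordinates of Q_n. The second hypothesis is the Appell property: the array
    is constant along diagonals, hence given by one sequence [a]. *)
Lemma appell_orthogonal_coef (c : nat -> {poly K}) (A B C : nat -> K) :
  c 0%N = 1 -> (forall n j, (c n.+1)`_j.+1 = (c n)`_j) ->
  (forall n, comb (appellH s) (c n.+1) = (A n *: 'X + (B n)%:P) * comb (appellH s) (c n)
      - C n *: (if n is m.+1 then comb (appellH s) (c m) else 0)) ->
  (forall n, 0 < (A n.+1 * A n)^* * C n.+1) ->
  forall n, c n = 'X^n.
Proof.
move=> c0 cS rec pos.
pose a k := (c k)`_0.
have cE k j : (c (j + k))`_j = a k by elim: j => [|j IH]; rewrite ?add0n ?addSn ?cS.
have c_gt n j : (n < j)%N -> (c n)`_j = 0.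
  elim: n j => [|n IH] [|j] //= nj; first by rewrite c0 coef1.
  by rewrite cS IH.
have a0 : a 0%N = 1 by rewrite /a c0 coef1.
have rec_coef n := comb_recurrence (appellH0 s) (size_appellH two_neq0 s_neq0 q_neq1)
  (mulX_appellH0 two_neq0 q_neq1) (mulX_appellH two_neq0 s_neq0 q_neq1) (rec n.+1).
have lead n : 1 = A n.+1 * up s n.+1.
  have cc k : (c k)`_k = 1 by rewrite -[X in c X]addn0 cE.
  have := rec_coef n n.+2; rewrite coef_mulX_coef !cc mulr1.
  rewrite (c_gt n.+1 n.+3) ?(c_gt n.+1 n.+2) ?(c_gt n n.+2) //.
  by rewrite !mulr0 !addr0 subr0.
have diag k j n : n = (j + k)%N -> (c n)`_j = a k by move=> ->; exact: cE.
have rel1 m : a 1%N = A m.+1 * (up s m * a 1%N) + B m.+1.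
  have := rec_coef m m.+1; rewrite coef_mulX_coef.
  rewrite (diag 1%N m.+1) ?addn1 // (diag 1%N m) ?addn1 //.
  by rewrite (diag 0%N m.+1 m.+1) ?addn0 // !c_gt // a0 !mulr0 addr0 subr0 mulr1.
(* The coefficient of h_(m+1) in the recurrence at n = k + m + 2. Taking k = 0, 1, 2 with k + m
   fixed supplies the last three equations needed below. *)
have rel k m : a k.+2 = A (k + m).+2 * (up s m * a k.+2 + down s m.+1 * a k)
    + B (k + m).+2 * a k.+1 - C (k + m).+2 * a k.
  have := rec_coef (k + m).+1 m.+1; rewrite coef_mulX_coef.
  rewrite (diag k.+2 m.+1 (k + m).+3) ?(diag k.+2 m (k + m).+2)
    ?(diag k m.+2 (k + m).+2) //; try lia.
  by rewrite (diag k.+1 m.+1 (k + m).+2) ?(diag k m.+1 (k + m).+1) //; lia.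
have rel0 m : a 2%N = A m.+2 * (up s m * a 2%N + down s m.+1) + B m.+2 * a 1%N - C m.+2.
  by have := rel 0%N m; rewrite a0 !mulr1.
have eqs m := appell_recurrence_relations two_neq0 s_neq0 q_neq1
  (lead m.+3) (rel1 m.+3) (rel0 m.+2) (rel 1%N m.+1) (rel 2%N m).
(* The values of X at n = 4 and n = 5 differ because q is neither 0 nor 1. *)
have ne : s ^+ 2 ^+ 4 != s ^+ 2 ^+ 5.
  rewrite [s ^+ 2 ^+ 5]exprS -subr_eq0 -[X in X - _]mul1r -mulrBl.
  exact: mulf_neq0 (q_neq1 0%N) (expf_neq0 _ (expf_neq0 _ s_neq0)).
have [eC e3 e4] := eqs 0%N; have [_ e3' e4'] := eqs 1%N.
have [f1 f2] := affine_eq0 ne s_neq0 e3 e3'.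
have [f3 f4] := affine_eq0 ne (expf_neq0 2 s_neq0) e4 e4'.
have {e3 e3' e4 e4'} sol :=
  appell_relations_solve two_neq0 s_neq0 (q_neq1 0%N) f1 f2 f3 f4.
have q5 := q_neq1 4.
have four := four_neq0 two_neq0.
have C4 : C 4%N != 0 by apply: contraL (pos 3%N) => /eqP ->; rewrite mulr0 ltxx.
have A_E n : A n.+1 = upV_scale n.+1 * s ^+ n.+1.
  by rewrite -upV -[A _]mulr1 -[1](mulfV (up_neq0 n.+1)) mulrA -lead mul1r.
have a12 : a 1%N = 0 /\ a 2%N = 0.
  case: sol => // -[ea1 ea2].
    (* In the q^-1-Hermite case C_4 is a negative multiple of 1/s and A_4 A_3 a positive multiple of
       s^7, so the positivity condition would need s^*^7 / s < 0. *)
    have eC4 : C 4%N = - ((1 - s ^+ 2) ^+ 2 / (4 * (1 - s ^+ 2 ^+ 5)) / s).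
      move: q5 eC; rewrite ea1 ea2 [s ^+ 2 ^+ 5]exprS; move: (s ^+ 2 ^+ 4) => X q5 eC.
      by apply: (mulfI q5); rewrite eC; field; rewrite ?s_neq0 ?q5 ?four.
    have := pos 3%N; rewrite !A_E eC4.
    have -> : upV_scale 4 * s ^+ 4 * (upV_scale 3 * s ^+ 3) =
        upV_scale 4 * upV_scale 3 * s ^+ 7.
      by ring.
    have r_gt0 : 0 < upV_scale 4 * upV_scale 3 by rewrite mulr_gt0 ?upV_scale_gt0.
    rewrite rmorphM rmorphXn /= (conj_Creal (gtr0_real r_gt0)).
    rewrite mulrN oppr_gt0 mulrACA lt_gtF //.
    rewrite mulr_gt0 ?conj_pow_div_gt0 // mulr_gt0 //.
    rewrite divr_gt0 ?mulr_gt0 ?exprn_gt0 ?ltr0n //;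
      exact: q_lt1 0%N.
  have : (1 - s ^+ 2 ^+ 5) * C 4%N = 0.
    rewrite [s ^+ 2 ^+ 5]exprS eC ea1 ea2; move: (s ^+ 2 ^+ 4) => X.
    by field; rewrite ?s_neq0.
  by move/eqP; rewrite mulf_eq0 (negPf q5) (negPf C4).
(* The coefficient of h_0 expresses a_(k+3) linearly through a_(k+2) and a_(k+1), without a constant
   term. *)
have {sol} a_eq0 k : a k.+1 = 0.
  elim/ltn_ind: k => -[_|[_|k IH]]; rewrite ?a12.1 ?a12.2 //.
  have := rec_coef k.+1 0%N; rewrite coef_mulX_coef add0r (diag k.+1 1%N k.+2) //.
  by rewrite -/(a k.+3) -/(a k.+2) -/(a k.+1) (IH k) // (IH k.+1) // !mulr0 addr0 subr0.
move=> n; apply/polyP => j; rewrite coefXn.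
have [jn|nj|->] := ltngtP j n; last by rewrite (diag 0%N) ?addn0.
  by rewrite (diag (n - j)%N) -?(subnSK jn) ?a_eq0 // subnSK // subnKC // ltnW.
by rewrite c_gt.
Qed.

(** A_(n+1) A_n and C_(n+1) are both positive multiples of s^(2n+1), so the phases cancel against
    the conjugate. *)
Lemma appellH_recurrence_pos n :
  0 < ((up s n.+1)^-1 * (up s n)^-1)^* * (down s n / up s n.+1).
Proof.
rewrite !upV /down.
have -> : (1 - s ^+ 2) * s ^+ n / 4 * (upV_scale n.+1 * s ^+ n.+1) =
    (1 - s ^+ 2) / 4 * upV_scale n.+1 * (s ^+ n.+1 * s ^+ n) by ring.
have -> : upV_scale n.+1 * s ^+ n.+1 * (upV_scale n * s ^+ n) =
    upV_scale n.+1 * upV_scale n * (s ^+ n.+1 * s ^+ n) by ring.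
have r_gt0 : 0 < upV_scale n.+1 * upV_scale n by rewrite mulr_gt0 ?upV_scale_gt0.
rewrite rmorphM /= (conj_Creal (gtr0_real r_gt0)) mulrACA.
rewrite [X in _ * X]mulrC -normCK; apply: mulr_gt0.
  by rewrite !mulr_gt0 ?upV_scale_gt0 ?invr_gt0 ?ltr0n // (q_lt1 0%N).
by rewrite exprn_gt0 // normr_gt0 mulf_neq0 ?expf_neq0.
Qed.

End Classification.

(** * The Askey-Wilson operator in coordinates *)

Section AskeyWilson.
Variables (R : realType) (q : R).
Hypotheses (q_gtN1 : -1 < q) (q_lt1R : q < 1) (q_neq0 : q != 0).

Notation s := (qhalf q).

Lemma qhalf_sqr : s ^+ 2 = q%:C.
Proof. exact: sqrtCK. Qed.

Lemma qhalf_neq0 : s != 0.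
Proof. by rewrite sqrtC_eq0 (inj_eq (@complexI R)). Qed.

Lemma oneB_qhalf_gt0 n : 0 < 1 - s ^+ 2 ^+ n.+1.
Proof.
rewrite qhalf_sqr -rmorphXn -[1](rmorph1 (real_complex R)) -rmorphB ltcR subr_gt0.
rewrite (le_lt_trans (ler_norm _)) // normrX exprn_ilt1 //.
by rewrite ltr_norml q_gtN1.
Qed.

Lemma qHermite_AppellE n : qHermite_Appell q n = appellH s n.
Proof. by rewrite /appellH /appell_coef qhalf_sqr. Qed.

Lemma expi_inv (t : R) : (expi t)^-1 = cos t -i* sin t.
Proof.
have e : expi t * (cos t -i* sin t) = 1.
  apply/eqP; rewrite eq_complex /= !mulrN opprK -!expr2 cos2Dsin2 eqxx /=.
  by rewrite addrC mulrC subrr.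
rewrite -[LHS]mulr1 -e mulKf //; apply: contra_eq_neq e => ->.
by rewrite mul0r eq_sym oner_eq0.
Qed.

Lemma expi_neq0 (t : R) : expi t != 0.
Proof.
rewrite eq_complex /=; apply/negP => /andP[/eqP c0 /eqP s0].
by have /eqP := cos2Dsin2 t; rewrite c0 s0 expr0n addr0 eq_sym oner_eq0.
Qed.

Lemma joukowski_expi (t : R) : (expi t + (expi t)^-1) / 2 = (cos t)%:C.
Proof.
rewrite expi_inv; apply: (mulIf (_ : 2 != 0)); first by rewrite pnatr_eq0.
rewrite divfK ?pnatr_eq0 // mulr_natr mulr2n; apply/eqP; rewrite eq_complex /=.
by rewrite subrr addr0 !eqxx.
Qed.

Lemma expi_subV_neq0 (t : R) : sin t != 0 -> expi t - (expi t)^-1 != 0.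
Proof.
move=> t0; rewrite expi_inv eq_complex /= negb_and opprK.
by rewrite -mulr2n mulrn_eq0 /= t0 orbT.
Qed.

Lemma aw_D_comb (c : {poly R[i]}) (t : R) : sin t != 0 ->
  aw_D q (comb (appellH s) c) t = (comb (appellH s) (drop_poly 1 c)).[(cos t)%:C].
Proof.
move=> t0; have two : 2 != 0 :> R[i] by rewrite pnatr_eq0.
have qn n : 1 - s ^+ 2 ^+ n.+1 != 0 by rewrite gt_eqF ?oneB_qhalf_gt0.
have s0 := qhalf_neq0; have z0 := expi_neq0 t.
(* This is delta_q x at the given angle; it is nonzero because q != 1 and sin t != 0. *)
pose w := (s - s^-1) * (expi t - (expi t)^-1) / 2.
have w0 : w != 0.
  have e : s - s^-1 = - ((1 - s ^+ 2) / s) by field; rewrite s0.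
  by rewrite /w e !mulf_neq0 ?oppr_eq0 ?mulf_neq0 ?invr_eq0 ?expi_subV_neq0 // (qn 0%N).
rewrite /aw_D; have -> : aw_delta q 'X (expi t) = w.
  by rewrite /aw_delta /joukowski !hornerX /w; field; rewrite ?z0 ?s0 ?two.
apply: (mulIf w0); rewrite divfK // /aw_delta /joukowski.
rewrite (@comb_widen _ _ c (size c).+1) //.
rewrite (@comb_widen _ _ (drop_poly 1 c) (size c)); last first.
  by rewrite size_drop_poly leq_subr.
have hZ a m x : (a *: appellH s m).[x] = a * (appellH s m).[x] by rewrite hornerZ.
(* The h_0 term is constant and cancels in delta_q, which leaves the shifted sum. *)
rewrite !horner_sum !big_ord_recl !hZ appellH0 !hornerC opprD addrACA subrr add0r.
rewrite -sumrB mulr_suml; apply: eq_bigr => i _.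
rewrite !hZ -mulrBr appellH_shift_sub // joukowski_expi coef_drop_poly addn1 -/w.
by rewrite mulrCA mulrC.
Qed.

End AskeyWilson.

(** * From angles to polynomials, the case q = 0, and the equivalence *)

Lemma poly_cos_eq0 (R : realType) (p : {poly R[i]}) :
  (forall t : R, sin t != 0 -> p.[(cos t)%:C] = 0) -> p = 0.
Proof.
move=> p_cos; apply/eqP/negPn/negP => p0.
(* Infinitely many points of ]0, 1[, each the cosine of an angle with nonzero sine. *)
pose f (i : nat) : R[i] := (i.+2%:R^-1)%:C.
have f_inj : injective f.
  by move=> i j /complexI/invr_inj/eqP; rewrite eqr_nat => /eqP[].
have rootf i : root p (f i).
  have gt0 : 0 < i.+2%:R^-1 :> R by rewrite invr_gt0 ltr0n.
  have lt1 : i.+2%:R^-1 < 1 :> R by rewrite invf_lt1 ?ltr0n // ltr1n.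
  have le : -1 <= (i.+2%:R^-1 : R) <= 1.
    by rewrite (ltW lt1) andbT (le_trans _ (ltW gt0)) // oppr_le0 ler01.
  have fE : cos (acos i.+2%:R^-1) = i.+2%:R^-1 :> R by rewrite acosK // in_itv.
  apply/eqP; rewrite /f -fE p_cos // sin_acos // gt_eqF // sqrtr_gt0 subr_gt0.
  by rewrite expr_lt1 // ltW.
have := max_poly_roots p0 (rs := map f (iota 0 (size p))).
rewrite size_map size_iota ltnn map_inj_uniq // iota_uniq => H.
by apply: (@notF (H _ isT)); apply/allP => x /mapP[i _ ->].
Qed.

(** With 0^-1 = 0 both shifted points coincide, so D_q Q_1 vanishes instead of being 1. *)
Lemma not_Dq_Appell0 (R : realType) (Q : nat -> {poly R[i]}) :
  Q 0%N = 1 -> ~ Dq_Appell 0 Q.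
Proof.
move=> Q0 /(_ 0%N (pi / 2)); rewrite sin_pihalf oner_eq0 => /(_ isT).
rewrite /aw_D /aw_delta /qhalf sqrtC0 invr0 subrr mul0r Q0 hornerC => /eqP.
by rewrite eq_sym oner_eq0.
Qed.

Theorem theorem1 (R : realType) (q : R) (hq1 : -1 < q) (hq2 : q < 1)
    (Q : nat -> {poly R[i]}) (hQ : polynomial_set Q) (hQ0 : Q 0%N = 1) :
  (orthogonal_polynomial_set Q /\ Dq_Appell q Q)
  <-> (forall n : nat, Q n = qHermite_Appell q n).
Proof.
have [q0|q_neq0] := eqVneq q 0.
  split=> [[_]|QE]; first by rewrite q0 => /not_Dq_Appell0.
  (* For q = 0 the scalar at n = 2 contains s^1 = 0, so Q_2 would vanish. *)
  have := hQ 2%N; rewrite QE /qHermite_Appell /qhalf q0 sqrtC0 expr0n mulr0 mul0r scale0r.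
  by rewrite size_poly0.
have s0 := qhalf_neq0 q_neq0; have pos := oneB_qhalf_gt0 hq1 hq2.
have qn n : 1 - qhalf q ^+ 2 ^+ n.+1 != 0 by rewrite gt_eqF.
have two : 2 != 0 :> R[i] by rewrite pnatr_eq0.
pose h := appellH (qhalf q).
have h0 : h 0%N = 1 by exact: appellH0.
have hs := size_appellH two s0 qn.
have hX0 := mulX_appellH0 two qn; have hX := mulX_appellH two s0 qn.
split=> [[[_ [A [B [C [rec _ Cpos]]]]] appell] n|QE].
  have [c cE] := choice (fun m => comb_surj h0 hX0 hX (Q m)).
  have cI := comb_inj hs.
  have c0 : c 0%N = 1 by apply: cI; rewrite -cE hQ0 -polyC1 comb_const.
  have cS m j : (c m.+1)`_j.+1 = (c m)`_j.
    (* Both coordinate vectors give the same values at all cos t with sin t != 0. *)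
    suff -> : c m = drop_poly 1 (c m.+1) by rewrite coef_drop_poly addn1.
    apply: cI; apply/eqP; rewrite -subr_eq0; apply/eqP/poly_cos_eq0 => t t0.
    by rewrite hornerD hornerN -cE -appell // cE aw_D_comb // subrr.
  have rec' m : comb h (c m.+1) = (A m *: 'X + (B m)%:P) * comb h (c m)
      - C m *: (if m is k.+1 then comb h (c k) else 0).
    by case: m => [|k]; rewrite -!cE rec.
  have cX := appell_orthogonal_coef s0 pos c0 cS rec' Cpos.
  by rewrite cE cX combXn qHermite_AppellE.
have QH n : Q n = comb h 'X^n by rewrite QE qHermite_AppellE combXn.
split; last first.
  move=> n t t0; rewrite !QH aw_D_comb //; congr (comb h _).[_].
  by apply/polyP => j; rewrite coef_drop_poly !coefXn addn1.
(* The relation x h_n = u_n h_(n+1) + v_(n-1) h_(n-1) divided by u_n; C_0 multiplies P_(-1) = 0 and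
   is set to 0. *)
split=> //; exists (fun n => (up (qhalf q) n)^-1), (fun=> 0),
  (fun n => if n is k.+1 then down (qhalf q) k / up (qhalf q) n else 0).
split=> [n|n|n]; last 2 first.
- by rewrite mulr0 rpred0.
- exact: appellH_recurrence_pos.
rewrite addr0 !QE !qHermite_AppellE -scalerAl.
have u0 := up_neq0 s0 pos; case: n => [|n]; rewrite ?QE ?qHermite_AppellE.
  by rewrite hX0 scalerA mulVf // scale1r scale0r subr0.
rewrite hX scalerDr [_ *: (up _ _ *: _)]scalerA mulVf // scale1r.
by rewrite [_ *: (down _ _ *: _)]scalerA mulrC addrK.
Qed.
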